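(* Let $B$ be a Polish metric space and let $\mathcal{X}=(X,d_X,\pi_X,\mu_X)$ and $\mathcal{Y}=(Y,d_Y,\pi_Y,\mu_Y)$ be $mm$-fields over $B$. Then $$d_{GP}(\mathcal{X},\mathcal{Y})=\frac12\inf\{\epsilon>0\colon \text{there exists an }\epsilon\text{-coupling }\mu\in C(\mu_X,\mu_Y)\}.$$
   Context: A Polish metric space is a complete separable metric space. Fix a Polish metric space $(B,d_B)$. A $B$-field is a triple $(X,d_X,\pi_X)$ with $(X,d_X)$ a Polish metric space and $\pi_X\colon X\to B$ 1-Lipschitz. An $mm$-field over $B$ is a quadruple $\mathcal{X}=(X,d_X,\pi_X,\mu_X)$, where $(X,d_X,\pi_X)$ is a $B$-field and $\mu_X$ is a Borel probability measure on $X$. An isometric embedding $\Phi\colon\mathcal{X}\Rightarrow\mathcal{Z}$ of $B$-fields over $B$ is a distance-preserving map $\phi\colon X\to Z$ with $\pi_Z\circ\phi=\pi_X$. The Gromov-Prokhorov distance is $d_{GP}(\mathcal{X},\mathcal{Y}):=\inf_{\mathcal{Z},\Phi,\Psi}d_P^Z(\phi_*(\mu_X),\psi_*(\mu_Y))$, where the infimum is over all $B$-fields $\mathcal{Z}=(Z,d_Z,\pi_Z)$ and isometric embeddings $\Phi,\Psi$ of (the underlying $B$-fields of) $\mathcal{X},\mathcal{Y}$ into $\mathcal{Z}$ over $B$, and $d_P^Z$ is the Prokhorov distance between Borel probability measures on $Z$. $C(\mu_X,\mu_Y)$ is the set of couplings, i.e. Borel probability measures on $X\times Y$ with marginals $\mu_X$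 and $\mu_Y$. For a relation $R\subseteq X\times Y$, $$\mathrm{dis}_{\pi_X,\pi_Y}(R):=\max\Big(\sup_{(x,y),(x',y')\in R}|d_X(x,x')-d_Y(y,y')|,\ 2\sup_{(x,y)\in R}d_B(\pi_X(x),\pi_Y(y))\Big),$$ with the supremum over the empty set equal to $0$. For $\epsilon\ge0$, a coupling $\mu\in C(\mu_X,\mu_Y)$ is an $\epsilon$-coupling if there is a Borel subset $R$ of $X\times Y$ (not assumed to be a correspondence) with $\mu(R)\ge 1-\epsilon/2$ and $\mathrm{dis}_{\pi_X,\pi_Y}(R)\le\epsilon$. *)

(* Defs.v *)
From HB Require Import structures.
From mathcomp Require Import all_boot all_order all_algebra.
From mathcomp Require Import all_classical all_reals all_analysis.

Set Implicit Arguments.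
Unset Strict Implicit.
Unset Printing Implicit Defensive.

Import Order.TTheory GRing.Theory Num.Theory.
Import numFieldNormedType.Exports.

Local Open Scope classical_set_scope.
Local Open Scope ring_scope.

HB.mixin Record isSeparable T & Topological T := {
  separable_subproof : exists2 D : set T, countable D & dense D
}.

(* The library's [Complete] is pointed, so these spaces are nonempty.  Nothing
   is lost: an mm-field carries a probability measure, hence it, its base and
   every space it embeds into are nonempty. *)
#[short(type="polishMetricType")]
HB.structure Definition PolishMetric (R : realType) :=
  {T of Metric R T & Complete T & isSeparable T}.

Notation borel T := (g_sigma_algebraType (@open T)).

Record bField (R : realType) (B : polishMetricType R) := BField {
  bf_carrier :> polishMetricType R ;
  bf_proj : bf_carrier -> B ;
  bf_proj_lip : forall x y, mdist (bf_proj x) (bf_proj y) <= mdist x y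
}.

Record mmField (R : realType) (B : polishMetricType R) := MMField {
  mm_field :> bField B ;
  mm_meas : probability (borel mm_field) R
}.

Record embedding (R : realType) (B : polishMetricType R) (X Z : bField B) :=
  Embedding {
    emb_fun :> X -> Z ;
    emb_isom : forall x y, mdist (emb_fun x) (emb_fun y) = mdist x y ;
    emb_proj : forall x, bf_proj (emb_fun x) = bf_proj x
}.

Lemma emb_continuous (R : realType) (B : polishMetricType R) (X Z : bField B)
  (phi : embedding X Z) : continuous phi.
Proof.
move=> x; apply/cvg_ballP => e e0; near=> y.
rewrite ballEmdist /= emb_isom.
suff : ball x e y by rewrite ballEmdist.
by near: y; exact: nbhsx_ballx.
Unshelve. all: by end_near. Qed.

Lemma emb_measurable (R : realType) (B : polishMetricType R) (X Z : bField B)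
  (phi : embedding X Z) :
  measurable_fun [set: borel X] (phi : borel X -> borel Z).
Proof.
apply: (@measurability _ _ (borel X) (borel Z) _ _ (@open Z)) => // _ [U oU <-].
rewrite setTI; apply: sub_sigma_algebra.
by move/continuousP : (emb_continuous (phi := phi)); exact.
Qed.

Definition emb_mfun (R : realType) (B : polishMetricType R) (X Z : bField B)
    (phi : embedding X Z) : {mfun borel X >-> borel Z} :=
  mfun_Sub (mem_set (emb_measurable phi)).

Definition nbhd (R : realType) (Z : polishMetricType R) (A : set Z) (e : R) :
    set Z := [set z | exists2 a, A a & mdist a z < e].

Definition prokhorov (R : realType) (Z : polishMetricType R)
    (mu nu : probability (borel Z) R) : \bar R :=
  ereal_inf [set e%:E | e in [set e : R | 0 < e /\
    forall A : set (borel Z), measurable A ->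
      (mu A <= nu (nbhd A e) + e%:E)%E /\ (nu A <= mu (nbhd A e) + e%:E)%E]].

Definition dGP (R : realType) (B : polishMetricType R) (X Y : mmField B) :
    \bar R :=
  ereal_inf [set r | exists (Z : bField B) (phi : embedding X Z)
      (psi : embedding Y Z),
    r = prokhorov (distribution (mm_meas X) (emb_mfun phi))
                  (distribution (mm_meas Y) (emb_mfun psi))].

Definition is_coupling (R : realType) (B : polishMetricType R)
    (X Y : mmField B) (mu : probability (borel (X * Y)%type) R) : Prop :=
  (forall A : set (borel X), measurable A -> mu (fst @^-1` A) = mm_meas X A) /\
  (forall A : set (borel Y), measurable A -> mu (snd @^-1` A) = mm_meas Y A).

Arguments is_coupling {R B} X Y mu.

(* [ereal_sup set0] is [-oo], whereas distortion takes sup of set0 to be 0. *)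
Definition esup0 (R : realType) (S : set (\bar R)) : \bar R :=
  if `[< S = set0 >] then 0%E else ereal_sup S.

Definition dis (R : realType) (B : polishMetricType R) (X Y : bField B)
    (S : set (X * Y)) : \bar R :=
  maxe
    (esup0 [set `|mdist p.1 q.1 - mdist p.2 q.2|%:E | p in S & q in S])
    (2%:E * esup0 [set (mdist (bf_proj p.1) (bf_proj p.2))%:E | p in S])%E.

Arguments dis {R B} X Y S.

Definition eps_coupling (R : realType) (B : polishMetricType R)
    (X Y : mmField B) (e : R) (mu : probability (borel (X * Y)%type) R) :
    Prop :=
  is_coupling X Y mu /\
  exists S : set (borel (X * Y)%type),
    [/\ measurable S, ((1 - e / 2)%:E <= mu S)%E & (dis X Y S <= e%:E)%E].

Arguments eps_coupling {R B} X Y e mu.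

(* Main.v *)
Require Import Defs.
From HB Require Import structures.
From mathcomp Require Import all_boot all_order all_algebra.
From mathcomp Require Import all_classical all_reals all_analysis.
From mathcomp Require Import ring lra.
Import Order.TTheory GRing.Theory Num.Theory.
Import numFieldNormedType.Exports.
Local Open Scope classical_set_scope.
Local Open Scope ring_scope.

Set Implicit Arguments.
Unset Strict Implicit.
Unset Printing Implicit Defensive.

(** The two inequalities translate between a common field [Z] in which the two
    measures are Prokhorov-close and a coupling that is concentrated on a
    relation of small distortion.

    From a coupling to a field: if [S] has distortion at most [e], glue [X] and
    [Y] along [S], that is, put on the disjoint union the largest metric that
    extends both distances and places related points at distance [e / 2]
    ([bridge], [glue_dist]).  The distortion bound is exactly the triangle
    inequality of this metric; the space is again Polish, and the projections
    extend to a 1-Lipschitz map because those of related points are within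
    [e / 2] ([exists_gluing]).  The coupling moves all but [e / 2] of the mass
    by at most [e / 2], so the Prokhorov distance is at most [e / 2]
    ([coupling_prokhorov]).

    From a field to a coupling: this is Strassen's theorem.  The equality to be
    proved compares infima, so an arbitrarily small loss is allowed, and no
    compactness of measures is needed.  Cut [Z] into finitely many small cells
    and a remainder of small mass ([small_partition]).  Prokhorov's inequality
    for unions of cells is Hall's condition, with a defect, for the weights of
    the cells, so a Hall theorem for real weights ([fractional_hall]) gives a
    transport plan that moves little mass between cells that are far apart.
    Spreading the plan over the cells by means of product measures gives a
    coupling ([coupling_of_plan], [strassen_approx]), and the set of pairs whose
    images in [Z] are close has small distortion ([coupling_of_prokhorov]). *)

(** * Transport between finite weighted sets *)

Section transport.
Context {R : realFieldType} {I J : finType}.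
Implicit Types (E : {set I * J}) (U : {set I}) (V : {set J})
  (p : I -> R) (q : J -> R) (eta t : R).

(** [V] contains every neighbour of [U]: cuts are kept as pairs [(U, V)], rather
    than as [U] with its exact neighbourhood, so that they form a lattice under
    componentwise union and intersection, even while edges are being deleted. *)
Definition nbr_closed E U V := forall i j, i \in U -> (i, j) \in E -> j \in V.

(** Hall's marriage condition with real weights and defect [eta]. *)
Definition hall E (p : I -> R) (q : J -> R) (eta : R) := forall U V,
  nbr_closed E U V -> \sum_(i in U) p i <= \sum_(j in V) q j + eta.

Lemma sum_modular (K : finType) (f : K -> R) (A C : {set K}) :
  \sum_(i in A :|: C) f i + \sum_(i in A :&: C) f i =
  \sum_(i in A) f i + \sum_(i in C) f i.
Proof.
rewrite (big_setID A) /= finset.setUK [\sum_(i in C) _](big_setID A) /=.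
by rewrite finset.setDUl finset.setDv finset.set0U (finset.setIC C A); ring.
Qed.

Lemma sum_sub_at (K : finType) (f : K -> R) (t : R) k0 (A : {set K}) :
  \sum_(k in A) (f k - t * (k == k0)%:R) =
  \sum_(k in A) f k - t * (k0 \in A)%:R.
Proof.
rewrite sumrB -mulr_sumr; congr (_ - t * _).
have [kA|kA] := boolP (k0 \in A).
  by rewrite (bigD1 k0)//= eqxx big1 ?addr0// => k /andP[_ /negPf ->].
by rewrite big1// => k kin; case: eqP => // kk0; rewrite -kk0 kin in kA.
Qed.

(** Moving an amount [t] of mass along the edge [(i0, j0)] and then deleting this
    edge preserves Hall's condition for a suitable [t].  Only two kinds of cuts
    constrain [t]: a cut that the deleted edge leaves ([i0] in [U], [j0] outside
    [V]) bounds it from below, and a cut with [i0] outside [U] and [j0] in [V]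
    bounds it from above.  Every lower bound is below every upper bound because
    the union and the intersection of two such cuts are cuts for the undeleted
    relation, and sums are modular; the bounds [p i0] and [q j0] are treated in
    the same way.  Taking the largest lower bound is therefore safe. *)
Lemma hall_push E p q eta i0 j0 :
  (forall i, 0 <= p i) -> (forall j, 0 <= q j) ->
  (i0, j0) \in E -> hall E p q eta ->
  exists t, [/\ 0 <= t, t <= p i0, t <= q j0 &
    hall (E :\ (i0, j0)) (fun i => p i - t * (i == i0)%:R)
         (fun j => q j - t * (j == j0)%:R) eta].
Proof.
move=> p0 q0 E0 hallE; set E' := E :\ _.
pose crit (UV : {set I} * {set J}) :=
  [&& i0 \in UV.1, j0 \notin UV.2 &
     [forall i, forall j, (i \in UV.1) ==> ((i, j) \in E') ==> (j \in UV.2)]].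
pose gap (UV : {set I} * {set J}) :=
  \sum_(i in UV.1) p i - \sum_(j in UV.2) q j - eta.
pose t := \big[Num.max/0]_(UV | crit UV) gap UV.
have critP U V : i0 \in U -> j0 \notin V -> nbr_closed E' U V -> crit (U, V).
  move=> iU jV UV; rewrite /crit /= iU jV /=.
  apply/forallP => i; apply/forallP => j; apply/implyP => iU'.
  by apply/implyP; exact: UV.
have critE UV : crit UV ->
    [/\ i0 \in UV.1, j0 \notin UV.2 & nbr_closed E' UV.1 UV.2].
  move=> /and3P[iU jV /forallP H]; split => // i j iU' ijE.
  by move: (H i) => /forallP/(_ j)/implyP/(_ iU')/implyP/(_ ijE).
have tmax c : 0 <= c -> (forall UV, crit UV -> gap UV <= c) -> t <= c.
  move=> c0 H; rewrite /t; elim/big_ind: _ => // x y xc yc.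
  by rewrite ge_max xc.
have Ecase i j : (i, j) \in E -> (i, j) \in E' \/ (i = i0 /\ j = j0).
  rewrite in_setD1 => ->; case: eqP => [[-> ->]|]; by [right|left].
exists t; split.
- by apply: bigmax_ge_id.
- apply: tmax => // -[U V] /critE[/= iU jV UV]; rewrite /gap /=.
  have : nbr_closed E (U :\ i0) V.
    move=> i j; rewrite in_setD1 => /andP[ii0 iU'] /Ecase[|[ii0']].
      exact: UV.
    by rewrite ii0' eqxx in ii0.
  move/hallE; rewrite (big_setD1 i0 iU) /=; lra.
- apply: tmax => // -[U V] /critE[/= iU jV UV]; rewrite /gap /=.
  have : nbr_closed E U (j0 |: V).
    move=> i j iU' /Ecase[/(UV _ _ iU') jV'|[_ ->]]; rewrite in_setU1 ?eqxx//.
    by rewrite jV' orbT.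
  move/hallE; rewrite (big_setU1 _ jV) /=; lra.
- move=> U V UV; rewrite !sum_sub_at.
  have [iU|iU] := boolP (i0 \in U); have [jV|jV] := boolP (j0 \in V);
    rewrite ?mulr1 ?mulr0 ?subr0.
  + have /hallE : nbr_closed E U V.
      by move=> i j iU' /Ecase[|[_ ->//]]; exact: UV.
    lra.
  + have : gap (U, V) <= t by apply: le_bigmax_cond; exact: critP.
    rewrite /gap /=; lra.
  (* The uncrossing step: [U1, V1] is any cut bounding [t] from below. *)
  + suff : t <= \sum_(j in V) q j + eta - \sum_(i in U) p i by lra.
    have UVE : nbr_closed E U V.
      move=> i j iU' /Ecase[|[ii0]]; first exact: UV.
      by rewrite ii0 (negPf iU) in iU'.
    apply: tmax => [|[U1 V1] /critE[/= iU1 jV1 UV1]].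
      by rewrite subr_ge0; exact: hallE.
    have h1 : nbr_closed E (U1 :|: U) (V1 :|: V).
      move=> i j; rewrite !inE => /orP[iU1'|iU'].
        by move=> /Ecase[/UV1 ->//|[_ ->]]; rewrite jV orbT.
      by move=> /UVE ->//; rewrite orbT.
    have h2 : nbr_closed E (U1 :&: U) (V1 :&: V).
      move=> i j; rewrite !inE => /andP[iU1' iU'] ijE.
      rewrite (UVE i)// andbT; case/Ecase : ijE => [/UV1 ->//|[ii0]].
      by rewrite ii0 (negPf iU) in iU'.
    have := sum_modular p U1 U; have := sum_modular q V1 V.
    move: (hallE _ _ h1) (hallE _ _ h2); rewrite /gap /=; lra.
  + apply: hallE => i j iU' /Ecase[|[ii0]]; first exact: UV.
    by rewrite ii0 (negPf iU) in iU'.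
Qed.

(** Hall's theorem with real weights and a defect: all but [eta] of the mass [p]
    can be carried along [E] without exceeding the capacities [q].  Deleting one
    edge at a time with [hall_push] gives an induction on the number of edges,
    without augmenting paths or linear programming; when no edge is left, the
    cut between everything and nothing says that at most [eta] of [p] remains. *)
Lemma fractional_hall E p q eta :
  (forall i, 0 <= p i) -> (forall j, 0 <= q j) -> hall E p q eta ->
  exists m : I -> J -> R, [/\ forall i j, 0 <= m i j,
    forall i j, (i, j) \notin E -> m i j = 0,
    forall i, \sum_j m i j <= p i, forall j, \sum_i m i j <= q j &
    \sum_i p i - eta <= \sum_i \sum_j m i j].
Proof.
have [n] := ubnP #|E|; elim: n => // n IHn in E p q * => /ltnSE En p0 q0 hallE.
have [E0|[[i0 j0] ijE]] := set_0Vmem E.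
  exists (fun _ _ => 0); split => //.
  - by move=> i; rewrite big1.
  - by move=> j; rewrite big1.
  - have /hallE : nbr_closed E [set: I]%SET finset.set0.
      by move=> i j _; rewrite E0 inE.
    rewrite big_set0 (eq_bigl xpredT) => [|i]; last by rewrite inE.
    move=> pT; rewrite [leRHS]big1 => [|i _]; last by rewrite big1.
    by rewrite subr_le0 -[eta]add0r.
have [t [t0 tp tq hall']] := hall_push p0 q0 ijE hallE.
have delta_le (K : finType) (f : K -> R) k0 : (forall k, 0 <= f k) -> t <= f k0 ->
    forall k, 0 <= f k - t * (k == k0)%:R.
  move=> f0 tf k; case: eqP => [->|_]; first by rewrite mulr1 subr_ge0.
  by rewrite mulr0 subr0.
have [|m [m0 mE mp mq mtot]] := IHn _ _ _ _ (delta_le _ _ _ p0 tp)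
    (delta_le _ _ _ q0 tq) hall'.
  by rewrite (leq_trans _ En)// [ltnRHS](cardsD1 (i0, j0)) ijE.
pose d i j : R := t * (i == i0)%:R * (j == j0)%:R.
have sumd (K : finType) (k0 : K) : \sum_k (k == k0)%:R = 1 :> R.
  by rewrite (bigD1 k0)//= eqxx big1 ?addr0// => k /negPf ->.
exists (fun i j => m i j + d i j); split.
- by move=> i j; rewrite addr_ge0// /d !mulr_ge0.
- move=> i j nE; rewrite mE ?add0r; last by rewrite in_setD1 negb_and nE orbT.
  rewrite /d; case: eqP => [ii|_]; last by rewrite mulr0 mul0r.
  case: eqP => [jj|_]; last by rewrite mulr0.
  by rewrite ii jj ijE in nE.
- by move=> i; rewrite big_split/= -mulr_sumr sumd mulr1 -lerBrDr.
- move=> j; rewrite big_split/= -mulr_suml -mulr_sumr sumd mulr1.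
  by rewrite -lerBrDr.
- under [leRHS]eq_bigr do rewrite big_split/= -mulr_sumr sumd mulr1.
  rewrite big_split/= -mulr_sumr sumd mulr1.
  move: mtot; rewrite sumrB -mulr_sumr sumd mulr1; lra.
Qed.

(** When [p] and [q] have the same total, what [fractional_hall] leaves over can
    be matched arbitrarily, here proportionally: the residual margins [a] and [b]
    have the same total [s <= eta], and [a i * b j / s] couples them. *)
Lemma transport_plan E p q eta :
  (forall i, 0 <= p i) -> (forall j, 0 <= q j) -> \sum_i p i = \sum_j q j ->
  hall E p q eta ->
  exists m : I -> J -> R, [/\ forall i j, 0 <= m i j,
    forall i, \sum_j m i j = p i, forall j, \sum_i m i j = q j &
    \sum_(ij | ij \notin E) m ij.1 ij.2 <= eta].
Proof.
move=> p0 q0 pq hallE.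
have [m [m0 mE mp mq mtot]] := fractional_hall p0 q0 hallE.
pose a i := p i - \sum_j m i j; pose b j := q j - \sum_i m i j.
pose s := \sum_i a i.
have a0 i : 0 <= a i by rewrite subr_ge0.
have b0 j : 0 <= b j by rewrite subr_ge0.
have sE : s = \sum_i p i - \sum_i \sum_j m i j by rewrite /s sumrB.
have sb : \sum_j b j = s by rewrite sumrB exchange_big/= sE pq.
have s0 : 0 <= s by apply: sumr_ge0.
have seta : s <= eta by rewrite sE; lra.
(* If [s = 0] the residual margins vanish, so dividing by zero is harmless. *)
have cancel_s x : (s = 0 -> x = 0) -> x * s / s = x.
  have [s00 /(_ s00) ->|sn0 _] := eqVneq s 0; first by rewrite !mul0r.
  by rewrite mulfK.
have rest0 (K : finType) (f : K -> R) : (forall k, 0 <= f k) ->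
    \sum_k f k = s -> forall k, s = 0 -> f k = 0.
  move=> f0 fs k s00; apply: (@psumr_eq0P R K xpredT f) => //.
  by rewrite fs.
exists (fun i j => m i j + a i * b j / s); split.
- by move=> i j; rewrite addr_ge0// divr_ge0// mulr_ge0.
- move=> i; rewrite big_split/= -mulr_suml -mulr_sumr sb cancel_s.
    by rewrite addrC subrK.
  by apply: (rest0 _ a).
- move=> j; rewrite big_split/= -mulr_suml -mulr_suml -/s (mulrC s) cancel_s.
    by rewrite addrC subrK.
  by apply: (rest0 _ b).
- apply: le_trans seta; rewrite big_split/= big1 ?add0r; last first.
    by move=> [i j] nE /=; rewrite mE.
  apply: (@le_trans _ _ (\sum_(ij : I * J) a ij.1 * b ij.2 / s)).
    rewrite [leRHS](bigID (fun ij => ij \in E))/= lerDr sumr_ge0// => ij _.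
    by rewrite divr_ge0// mulr_ge0.
  rewrite -(pair_big xpredT xpredT (fun i j => a i * b j / s))/=.
  under eq_bigr do rewrite -mulr_suml -mulr_sumr sb.
  by rewrite -mulr_suml -mulr_suml cancel_s.
Qed.

End transport.

(** * Couplings that realise a finite transport plan *)

Section finite_families_of_sets.
Context d (T : measurableType d) (R : realType).

Lemma finite_sum_measure (I : Type) (s : seq I)
    (nu : I -> {measure set T -> \bar R}) :
  exists mu : {measure set T -> \bar R},
    forall A, mu A = (\sum_(i <- s) nu i A)%E.
Proof.
elim: s => [|i s [mu muE]]; first by exists mzero => A; rewrite big_nil.
by exists (measure_add (nu i) mu) => A; rewrite [LHS]measure_addE big_cons muE.
Qed.

Lemma measure_bigcup_finType (mu : {measure set T -> \bar R}) (I : finType)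
    (U : {set I}) (F : I -> set T) :
  (forall i, measurable (F i)) -> trivIset setT F ->
  mu (\bigcup_(i in [set` U]) F i) = (\sum_(i in U) mu (F i))%E.
Proof.
move=> mF tF; rewrite measure_fin_bigcup//.
- by rewrite -(bigfs _ (index_enum_uniq I))// => i _; rewrite mem_index_enum.
- exact: sub_trivIset tF.
Qed.

Lemma measure_partition (mu : {measure set T -> \bar R}) (I : finType)
    (F : I -> set T) (A : set T) :
  (forall i, measurable (F i)) -> trivIset setT F ->
  (forall x, exists i, F i x) -> measurable A ->
  mu A = (\sum_i mu (A `&` F i))%E.
Proof.
move=> mF tF cF mA.
have := @measure_bigcup_finType mu I [set: I]%SET (fun i => A `&` F i).
rewrite (eq_bigl xpredT) => [<-|i]; last by rewrite inE.
- congr (mu _); apply/seteqP; split => [x Ax|x [i _ []//]].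
  by have [i Fix] := cF x; exists i => //=; rewrite inE.
- by move=> i; exact: measurableI.
- by apply: trivIset_setIl.
Qed.

End finite_families_of_sets.

Section coupling_of_plan.
Local Open Scope ereal_scope.
Context d1 d2 (T1 : measurableType d1) (T2 : measurableType d2) (R : realType).
Context (P : probability T1 R) (Q : probability T2 R).

(** A plan between the weights of the cells of two finite partitions comes from a
    coupling: on the cell [A i `*` C j] take the product measure, rescaled so
    that the cell gets mass [m i j].  Summing over one index recovers each
    margin.  Cells of product mass zero do no harm, since [m i j] is then zero as
    a nonnegative term of a vanishing row or column sum. *)
Lemma coupling_of_plan (I J : finType) (A : I -> set T1) (C : J -> set T2)
    (m : I -> J -> R) :
  (forall i, measurable (A i)) -> trivIset setT A -> (forall x, exists i, A i x) ->
  (forall j, measurable (C j)) -> trivIset setT C -> (forall x, exists j, C j x) ->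
  (forall i j, (0 <= m i j)%R) ->
  (forall i, (\sum_j m i j)%R = fine (P (A i))) ->
  (forall j, (\sum_i m i j)%R = fine (Q (C j))) ->
  exists pi : {measure set (T1 * T2) -> \bar R}, [/\
    forall U, measurable U -> pi (U `*` setT) = P U,
    forall V, measurable V -> pi (setT `*` V) = Q V &
    forall i j, pi (A i `*` C j) = (m i j)%:E].
Proof.
move=> mA tA cA mC tC cC m0 mP mQ.
pose p i := fine (P (A i)); pose q j := fine (Q (C j)).
have p0 i : (0 <= p i)%R by rewrite fine_ge0.
have q0 j : (0 <= q j)%R by rewrite fine_ge0.
have c0 i j : (0 <= m i j / (p i * q j))%R by rewrite divr_ge0// mulr_ge0.
have mAC ij : measurable (A ij.1 `*` C ij.2) by exact: measurableX.
pose nu (ij : I * J) : {measure set (T1 * T2) -> \bar R} :=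
  mscale (NngNum (c0 ij.1 ij.2)) (mrestr (P \x Q) (mAC ij)).
have [pi piE] := finite_sum_measure (index_enum (I * J)%type) nu.
have nuE ij U V : measurable U -> measurable V -> nu ij (U `*` V) =
    (m ij.1 ij.2 / (p ij.1 * q ij.2) *
     (fine (P (U `&` A ij.1)) * fine (Q (V `&` C ij.2))))%:E.
  move=> mU mV; rewrite /nu/= /mscale/= /mrestr/= -setXI.
  rewrite product_measure1E//; [|exact: measurableI|exact: measurableI].
  by rewrite !EFinM !fineK// fin_num_measure//; exact: measurableI.
have piXE U V : measurable U -> measurable V -> pi (U `*` V) =
    (\sum_i \sum_j m i j / (p i * q j) *
      (fine (P (U `&` A i)) * fine (Q (V `&` C j))))%R%:E.
  move=> mU mV; rewrite piE pair_big/= -sumEFin.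
  by apply: eq_bigr => ij _; exact: nuE.
have cancel_p i j : (m i j / p i * p i = m i j)%R.
  have [pi0|] := eqVneq (p i) 0%R; last by move=> ?; rewrite divfK.
  rewrite pi0 mulr0; apply/esym.
  by apply: (@psumr_eq0P R J xpredT (m i)) => //; rewrite mP.
have cancel_q i j : (m i j / q j * q j = m i j)%R.
  have [qj0|] := eqVneq (q j) 0%R; last by move=> ?; rewrite divfK.
  rewrite qj0 mulr0; apply/esym.
  by apply: (@psumr_eq0P R I xpredT (m^~ j)) => //; rewrite mQ.
have pu U i : measurable U -> (fine (P (U `&` A i)) / p i * p i)%R =
    fine (P (U `&` A i)).
  move=> mU; have [pi0|] := eqVneq (p i) 0%R; last by move=> ?; rewrite divfK.
  rewrite pi0 mulr0; apply/esym/le_anti.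
  rewrite fine_ge0// andbT -pi0 fine_le//; [| |apply: le_measure];
    rewrite ?inE ?fin_num_measure//; exact: measurableI.
have qv V j : measurable V -> (fine (Q (V `&` C j)) / q j * q j)%R =
    fine (Q (V `&` C j)).
  move=> mV; have [qj0|] := eqVneq (q j) 0%R; last by move=> ?; rewrite divfK.
  rewrite qj0 mulr0; apply/esym/le_anti.
  rewrite fine_ge0// andbT -qj0 fine_le//; [| |apply: le_measure];
    rewrite ?inE ?fin_num_measure//; exact: measurableI.
exists pi; split.
- move=> U mU; rewrite piXE//.
  rewrite [RHS](measure_partition _ mA tA cA mU).
  rewrite -sumEFin; apply: eq_bigr => i _.
  rewrite -[RHS]fineK ?fin_num_measure//; last exact: measurableI.
  congr (_%:E).
  under eq_bigr => j _.
    rewrite setTI -/(q j) invfM.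
    rewrite (_ : _ * _ = (m i j / q j * q j) * (fine (P (U `&` A i)) / p i))%R;
      last by ring.
    rewrite cancel_q; over.
  by rewrite -mulr_suml mP mulrC pu.
- move=> V mV; rewrite piXE//.
  rewrite [RHS](measure_partition _ mC tC cC mV).
  rewrite exchange_big/= -sumEFin; apply: eq_bigr => j _.
  rewrite -[RHS]fineK ?fin_num_measure//; last exact: measurableI.
  congr (_%:E).
  under eq_bigr => i _.
    rewrite setTI -/(p i) invfM.
    rewrite (_ : _ * _ = (m i j / p i * p i) * (fine (Q (V `&` C j)) / q j))%R;
      last by ring.
    rewrite cancel_p; over.
  by rewrite -mulr_suml mQ mulrC qv.
- move=> i j; rewrite piXE// (bigD1 i)//= (bigD1 j)//= big1 => [|j' j'j].
    rewrite big1 => [|i' i'i].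
      rewrite !setIid -/(p i) -/(q j) !addr0 invfM; congr (_%:E).
      rewrite [LHS](_ : _ = (m i j / p i * p i / q j * q j))%R; last by ring.
      by rewrite cancel_p cancel_q.
    rewrite big1// => j' _.
    suff -> : A i `&` A i' = set0 by rewrite measure0/= mul0r mulr0.
    by move/trivIsetP : tA => /(_ i i' Logic.I Logic.I); apply; rewrite eq_sym.
  suff -> : C j `&` C j' = set0 by rewrite measure0/= !mulr0.
  by move/trivIsetP : tC => /(_ j j' Logic.I Logic.I); apply; rewrite eq_sym.
Qed.

End coupling_of_plan.

(** * Borel sets and partitions of Polish metric spaces *)

Section polish.
Context {R : realType}.
Implicit Types T X Y Z : polishMetricType R.

Lemma dense_sequence T : exists z : nat -> T,
  forall x e, 0 < e -> exists k, mdist (z k) x < e.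
Proof.
have [D cD dD] := @separable_subproof R T.
have /pfcard_geP[D0|[z]] := cD.
  have [x []] := dD setT (ex_intro _ point Logic.I) openT.
  by rewrite D0.
exists z => x e e0.
have [] := dD (ball x e)°; last 1 first.
- move=> y [/interior_subset xy Dy]; have [k _ kz] := @surj _ _ _ _ z _ Dy.
  by exists k; rewrite kz metric_sym; move: xy; rewrite ballEmdist.
- by exists x; exact: nbhsx_ballx.
- exact: open_interior.
Qed.

Lemma open_ball_metric (T : metricType R) (x : T) e : open (ball x e).
Proof.
rewrite openE => y; rewrite ballEmdist /= => xy.
apply/nbhs_ballP; exists (e - mdist x y); rewrite /= ?subr_gt0//.
move=> z; rewrite !ballEmdist/= => yz.
by rewrite (le_lt_trans (metric_triangle x y z))// -ltrBrDl.
Qed.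

Lemma open_nbhd Z (A : set Z) e : open (nbhd A e).
Proof.
have -> : nbhd A e = \bigcup_(a in A) ball a e.
  by apply/seteqP; split => z [a Aa az]; exists a => //;
    move: az; rewrite ballEmdist.
by apply: bigcup_open => a _; exact: open_ball_metric.
Qed.

Lemma open_borel (T : ptopologicalType) (U : set T) : open U ->
  measurable (U : set (borel T)).
Proof. exact: sub_sigma_algebra. Qed.

(** In separable spaces the Borel sets of the product are measurable for the
    product of the Borel sigma-algebras: an open set is the countable union of
    the boxes of radius [1/(n+1)] around points of dense sequences that it
    contains.  This is what turns a coupling built on the product sigma-algebra
    into a Borel measure on the product space. *)
Lemma product_borel X Y :
  measurable_fun [set: (borel X * borel Y)%type]
    (fun w => w : borel (X * Y)%type).
Proof.
apply: (@measurability _ _ _ (borel (X * Y)%type) _ _ (@open (X * Y)%type)) => //.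
move=> _ [U oU <-]; rewrite setTI preimage_id.
have [a aP] := dense_sequence X; have [b bP] := dense_sequence Y.
pose r n : R := n.+1%:R^-1.
pose box i j n : set (borel X * borel Y)%type :=
  (ball (a i) (r n) : set (borel X)) `*` (ball (b j) (r n) : set (borel Y)).
have -> : U = \bigcup_i \bigcup_j \bigcup_n
    if `[< box i j n `<=` U >] then box i j n else set0.
  apply/seteqP; split; last first.
    by move=> w [i _ [j _ [n _]]]; case: asboolP => //; apply.
  move=> [x y] Uxy.
  have /nbhs_ballP[e /= e0 eU] : nbhs (x, y) U by exact: open_nbhs_nbhs.
  have [n ne] : exists n, r n < e / 2.
    have := near_infty_natSinv_lt (PosNum (divr_gt0 e0 (ltr0n R 2))).
    by move=> [n _ /(_ n (leqnn n))]; exists n.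
  have rn0 : 0 < r n by rewrite invr_gt0.
  have [i ai] := aP x _ rn0; have [j bj] := bP y _ rn0.
  exists i => //; exists j => //; exists n => //.
  rewrite ifT; first by split; rewrite /= ballEmdist.
  apply/asboolP => -[x' y'] []; rewrite /= !ballEmdist/= => ax by'.
  apply: eU; split => /=; rewrite ballEmdist/=.
    have := metric_triangle x (a i) x'; rewrite (metric_sym x (a i)); lra.
  have := metric_triangle y (b j) y'; rewrite (metric_sym y (b j)); lra.
apply: bigcupT_measurable => i; apply: bigcupT_measurable => j.
apply: bigcupT_measurable => n; case: ifP => // _.
by apply: measurableX; apply: open_borel; exact: open_ball_metric.
Qed.

(** Countably many small balls cover a separable space, and by continuity from
    below finitely many of them already carry all but [d] of two given
    probabilities.  Made disjoint, they are the cells [F (Some k)]; the part of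
    the space outside them is [F None]. *)
Lemma small_partition Z (mu nu : probability (borel Z) R) (d : R) : 0 < d ->
  exists n, exists F : option 'I_n -> set (borel Z), [/\
    forall k, measurable (F k), trivIset setT F, forall x, exists k, F k x,
    forall k x y, F (Some k) x -> F (Some k) y -> mdist x y < d &
    (mu (F None) <= d%:E)%E /\ (nu (F None) <= d%:E)%E].
Proof.
move=> d0; have [z zP] := dense_sequence Z.
pose G k : set (borel Z) := ball (z k) (d / 2).
pose U n := \big[setU/set0]_(k < n) G k.
have mG k : measurable (G k) by apply: open_borel; exact: open_ball_metric.
have mU n : measurable (U n) by apply: bigsetU_measurable.
have UT : \bigcup_n U n = setT.
  apply/seteqP; split => // x _; have [k kx] := zP x _ (divr_gt0 d0 (ltr0n R 2)).
  by exists k.+1 => //; rewrite /U big_ord_recr; right; rewrite /G/= ballEmdist.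
have tail (m : probability (borel Z) R) :
    \forall n \near \oo, (m (~` U n) <= d%:E)%E.
  have : m \o U @ \oo --> m (\bigcup_n U n).
    apply: nondecreasing_cvg_mu => //; first by rewrite UT.
    apply/nondecreasing_seqP => n; apply/subsetPset.
    by rewrite /U big_ord_recr/=; exact: subsetUl.
  rewrite UT probability_setT => /fine_cvg /cvgr_ge /(_ (1 - d)) H.
  have {H} : \forall n \near \oo, 1 - d <= (fine \o (m \o U)) n.
    by apply: H; rewrite gtrBl.
  apply: filterS => n /= Hn; rewrite probability_setC//.
  rewrite -(@fineK _ (m (U n))) ?fin_num_measure// lee_fin; lra.
have [n [mun nun]] : exists n, (mu (~` U n) <= d%:E)%E /\ (nu (~` U n) <= d%:E)%E.
  have := filterI (tail mu) (tail nu).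
  by move=> [n _ /(_ n (leqnn n))]; exists n.
pose F (k : option 'I_n) : set (borel Z) :=
  if k is Some i then seqDU G i else ~` U n.
exists n, F; split => //.
- case=> [k|]; last exact: measurableC.
  exact: seqDU_measurable.
- have tG := @trivIset_seqDU _ G.
  have subU (i : 'I_n) : seqDU G i `<=` U n.
    by rewrite /U bigsetU_seqDU -bigcup_mkord => x Gx; exists i => //=.
  move=> [i|] [j|] _ _ //= [x [Fi Fj]].
  + by congr Some; apply/val_inj; apply: (tG i j) => //; exists x.
  + by exfalso; apply: Fj; exact: subU Fi.
  + by exfalso; apply: Fi; exact: subU Fj.
- move=> x; have [|xU] := pselect (U n x); last by exists None.
  rewrite /U bigsetU_seqDU -bigcup_mkord => -[k /= kn Gx].
  by exists (Some (Ordinal kn)).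
- move=> k x y [Gx _] [Gy _]; move: Gx Gy; rewrite /G !ballEmdist/= => zx zy.
  have := metric_triangle x (z k) y; rewrite (metric_sym x (z k)); lra.
Qed.

End polish.

(** * An approximate form of Strassen's theorem *)

Section strassen.
Context {R : realType} (Z : polishMetricType R).
Context d1 d2 (T1 : measurableType d1) (T2 : measurableType d2).
Context (P : probability T1 R) (Q : probability T2 R).
Context (f : {mfun T1 >-> borel Z}) (g : {mfun T2 >-> borel Z}).

(** Strassen's theorem up to an arbitrarily small loss [2 * d]; the inequality of
    Prokhorov's definition is Hall's condition on the cells of a partition into
    small pieces.  Two cells are related when some of their points are closer
    than [e]; then all their points are closer than [e + 2 * d].  The leftover
    cell is related to nothing, and costs at most [d] on each side.  The loss
    is what makes a finite partition sufficient, in place of tightness and a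
    weak limit of couplings. *)
Lemma strassen_approx (e d : R) : 0 < d ->
  (forall A : set (borel Z), measurable A ->
    (distribution P f A <= distribution Q g (nbhd A e) + e%:E)%E) ->
  exists pi : {measure set (T1 * T2) -> \bar R}, [/\
    forall U, measurable U -> pi (U `*` setT) = P U,
    forall V, measurable V -> pi (setT `*` V) = Q V &
    forall S, measurable S ->
      (forall x y, mdist (f x : Z) (g y) < e + 2 * d -> S (x, y)) ->
      (pi (~` S) <= (e + 2 * d)%:E)%E].
Proof.
move=> d0 PQ; set mu := distribution P f in PQ; set nu := distribution Q g in PQ.
have [n [F [mF tF cF Fd [muN nuN]]]] := small_partition mu nu d0.
have disj i j : i <> j -> F i `&` F j = set0.
  by move/eqP=> ij; move/trivIsetP : tF => /(_ _ _ Logic.I Logic.I ij).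
pose p k := fine (mu (F k)); pose q k := fine (nu (F k)).
have p0 k : 0 <= p k by rewrite fine_ge0.
have q0 k : 0 <= q k by rewrite fine_ge0.
have sump (m : probability (borel Z) R) (U : {set option 'I_n}) :
    \sum_(k in U) fine (m (F k)) = fine (m (\bigcup_(k in [set` U]) F k)).
  rewrite (measure_bigcup_finType _ _ mF tF) sum_fine// => i _.
  exact: fin_num_measure.
have mcup (U : {set option 'I_n}) : measurable (\bigcup_(k in [set` U]) F k).
  by apply: fin_bigcup_measurable.
have sum1 (m : probability (borel Z) R) : \sum_k fine (m (F k)) = 1.
  have := sump m [set: option 'I_n]%SET.
  rewrite (eq_bigl xpredT) => [->|k]; last by rewrite inE.
  rewrite (_ : \bigcup_(_ in _) _ = setT) ?probability_setT//.
  by apply/seteqP; split => // x _; have [k Fk] := cF x; exists k => //=; rewrite inE.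
pose E : {set option 'I_n * option 'I_n} := [set kl | [&& kl.1 != None,
  kl.2 != None & `[< exists x y, [/\ F kl.1 x, F kl.2 y & mdist (x : Z) y < e] >]]]%SET.
have hallE : hall E p q (e + 2 * d).
  (* The leftover cell has no neighbours, so its mass is given up on the side
     of [mu]; on the side of [nu], the neighbourhood of [A] may meet it. *)
  move=> U V UV; pose A := \bigcup_(k in [set` (U :\ None)%SET]) F k.
  have mA : measurable A by exact: mcup.
  have pU : \sum_(k in U) p k <= fine (mu A) + d.
    rewrite /A -sump -/p.
    have muN' : p None <= d.
      by rewrite -lee_fin /p fineK ?fin_num_measure.
    have [NU|NU] := boolP (None \in U).
      by rewrite (big_setD1 _ NU) /= addrC lerD2l.
    rewrite (_ : (U :\ None)%SET = U) ?lerDl ?ltW//.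
    apply/setP => k; rewrite in_setD1; case: eqP => //= ->.
    by rewrite (negPf NU).
  have nbhdA : nbhd A e `<=` (\bigcup_(k in [set` V]) F k) `|` F None.
    move=> y [x [k /= kU Fx] xy]; have [[l|] Fy] := cF y; last by right.
    left; exists (Some l) => //=; move: kU; rewrite in_setD1 => /andP[kN kU].
    apply: (UV _ _ kU); rewrite inE /= kN /=; apply/asboolP.
    by exists x, y.
  have nuA : (nu (nbhd A e) <= (\sum_(l in V) q l + d)%:E)%E.
    apply: (@le_trans _ _ (nu ((\bigcup_(k in [set` V]) F k) `|` F None))).
      apply: le_measure => //; rewrite inE; last exact: measurableU.
      by apply: open_borel; exact: open_nbhd.
    apply: (@le_trans _ _ (nu (\bigcup_(k in [set` V]) F k) + nu (F None))%E).
      exact: measureU2.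
    by rewrite EFinD sump fineK ?fin_num_measure// leeD2l.
  have := PQ A mA.
  rewrite -(@fineK _ (mu A)) ?fin_num_measure// => muA.
  have {muA} := le_trans muA (leeD2r _ nuA).
  rewrite -EFinD lee_fin; lra.
have sumpq : \sum_k p k = \sum_k q k by rewrite !sum1.
have [m [m0 mp mq mE]] := transport_plan p0 q0 sumpq hallE.
pose Ff k := f @^-1` F k; pose Fg k := g @^-1` F k.
have mFf k : measurable (Ff k) by exact: measurable_funPTI.
have mFg k : measurable (Fg k) by exact: measurable_funPTI.
have tFf : trivIset setT Ff.
  apply/trivIsetP => i j _ _ /eqP/disj ij.
  by rewrite -preimage_setI ij preimage_set0.
have tFg : trivIset setT Fg.
  apply/trivIsetP => i j _ _ /eqP/disj ij.
  by rewrite -preimage_setI ij preimage_set0.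
have cFf x : exists k, Ff k x by exact: cF.
have cFg x : exists k, Fg k x by exact: cF.
have [pi [pi1 pi2 pim]] := coupling_of_plan mFf tFf cFf mFg tFg cFg m0 mp mq.
exists pi; split => // S mS Sfg.
have mFF kl : measurable (Ff kl.1 `*` Fg kl.2) by exact: measurableX.
rewrite (measure_partition pi mFF _ _ (measurableC mS)); first last.
- move=> [x y]; have [k kx] := cFf x; have [l ly] := cFg y.
  by exists (k, l).
- apply/trivIsetP => -[k l] [k' l'] _ _ kl; rewrite -setXI.
  have [kk|kk] := eqVneq k k'; last first.
    by move/trivIsetP : tFf => -> //; rewrite set0X.
  have ll : l != l' by apply: contraNneq kl => ->; rewrite kk.
  by move/trivIsetP : tFg => -> //; rewrite setX0.
rewrite (bigID (fun kl => kl \in E))/= big1 ?add0e; last first.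
  move=> [[k|] [l|]]; rewrite inE//= => /asboolP[x [y [Fx Fy xy]]].
  rewrite (_ : _ `&` _ = set0) ?measure0//.
  apply/seteqP; split => // -[x' y'] [/= nS [Fx' Fy']].
  apply: nS; apply: Sfg.
  have := metric_triangle (f x' : Z) x (g y').
  have := metric_triangle (x : Z) y (g y').
  have := Fd _ _ _ Fx' Fx; have := Fd _ _ _ Fy Fy'; lra.
apply: (@le_trans _ _ (\sum_(kl | kl \notin E) m kl.1 kl.2)%:E); last first.
  by rewrite lee_fin.
rewrite -sumEFin; apply: lee_sum => kl _; rewrite -pim.
by apply: le_measure; rewrite ?inE//; apply: measurableI => //; exact: measurableC.
Qed.

End strassen.

(** * Couplings from the Prokhorov distance in a common field *)

Lemma esup0_le (R : realType) (S : set (\bar R)) (e : \bar R) : (0 <= e)%E ->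
  (esup0 S <= e)%E <-> (forall x, S x -> (x <= e)%E).
Proof.
move=> e0; rewrite /esup0; case: asboolP => [->|_]; first by split.
by split=> [Se x Sx|Se]; [apply: le_trans Se; exact: ereal_sup_ubound|
  apply: ge_ereal_sup => x /Se].
Qed.

Lemma probability_of_measure d (T : measurableType d) (R : realType)
    (mu : {measure set T -> \bar R}) : mu setT = 1%E ->
  exists P : probability T R, forall A, P A = mu A.
Proof.
move=> mu1; exists (mnormalize mu (dirac point)) => A.
by rewrite /= /mnormalize mu1 onee_eq0/= invr1 mule1.
Qed.

Section fields.
Context {R : realType} {B : polishMetricType R}.

Lemma dis_leP (X Y : bField B) (S : set (X * Y)) (e : R) : 0 <= e ->
  (dis X Y S <= e%:E)%E <->
  (forall p q, S p -> S q -> `|mdist p.1 q.1 - mdist p.2 q.2| <= e) /\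
  (forall p, S p -> mdist (bf_proj p.1) (bf_proj p.2) <= e / 2).
Proof.
move=> e0; rewrite /dis ge_max.
have -> (x : \bar R) : (2%:E * x <= e%:E)%E = (x <= (e / 2)%:E)%E.
  by rewrite -lee_pdivlMl// -EFinM mulrC.
split=> [/andP[/esup0_le H1 /esup0_le H2]|[H1 H2]].
- split=> [p q Sp Sq|p Sp]; rewrite -lee_fin.
    by apply: H1; [rewrite lee_fin|exists p => //; exists q].
  by apply: H2; [rewrite lee_fin divr_ge0|exists p].
- apply/andP; split; apply/esup0_le; rewrite ?lee_fin ?divr_ge0//.
    by move=> _ [p Sp [q Sq <-]]; rewrite lee_fin; exact: H1.
  by move=> _ [p Sp <-]; rewrite lee_fin; exact: H2.
Qed.

Lemma emb_close_open (X Y Z : bField B) (phi : embedding X Z)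
    (psi : embedding Y Z) (r : R) :
  open [set w : X * Y | mdist (phi w.1) (psi w.2) < r].
Proof.
rewrite openE => -[x y] /= xyr.
apply/nbhs_ballP; pose e := (r - mdist (phi x) (psi y)) / 2.
exists e; first by rewrite /e /= divr_gt0// subr_gt0.
move=> [x' y'] [/=]; rewrite !ballEmdist/= -(emb_isom phi) -(emb_isom psi) => xx yy.
have := metric_triangle (phi x') (phi x) (psi y').
have := metric_triangle (phi x) (psi y) (psi y').
move: xx yy; rewrite (metric_sym (phi x') (phi x)) /e; lra.
Qed.

Lemma mdist_bf_proj (X Y Z : bField B) (phi : embedding X Z)
    (psi : embedding Y Z) x y :
  mdist (bf_proj x) (bf_proj y) <= mdist (phi x) (psi y).
Proof. by rewrite -(emb_proj phi) -(emb_proj psi) bf_proj_lip. Qed.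

(** The relation of the coupling is the set of pairs whose images in [Z] are at
    distance less than [e + 2 * d].  Its distortion is at most twice that bound
    by the triangle inequality in [Z], and its projections are close because
    the projection of [Z] is 1-Lipschitz. *)
Lemma coupling_of_prokhorov (X Y : mmField B) (Z : bField B)
    (phi : embedding X Z) (psi : embedding Y Z) (e d : R) : 0 < e -> 0 < d ->
  (forall A : set (borel Z), measurable A ->
    (distribution (mm_meas X) (emb_mfun phi) A <=
     distribution (mm_meas Y) (emb_mfun psi) (nbhd A e) + e%:E)%E) ->
  exists mu : probability (borel (X * Y)%type) R,
    eps_coupling X Y (2 * (e + 2 * d)) mu.
Proof.
move=> e0 d0 /(strassen_approx d0)[pi [pi1 pi2 pi3]].
have [pr prE] : exists pr : probability (borel X * borel Y)%type R,
    forall A, pr A = pi A.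
  by apply: probability_of_measure; rewrite -setXTT pi1// probability_setT.
pose j : {mfun (borel X * borel Y)%type >-> borel (X * Y)%type} :=
  mfun_Sub (mem_set (@product_borel R X Y)).
pose mu : probability (borel (X * Y)%type) R := distribution pr j.
have muE A : mu A = pi A by exact: prE.
exists mu; split; first split=> A mA.
- by rewrite muE -pi1// setXT.
- by rewrite muE -pi2// setTX.
pose r := e + 2 * d.
pose S : set (borel (X * Y)%type) := [set w | mdist (phi w.1) (psi w.2) < r].
have mS : measurable S by apply: sub_sigma_algebra; exact: emb_close_open.
exists S; split => //.
- have piS : (mu (~` S) <= r%:E)%E.
    rewrite muE; apply: pi3 => //; have := @measurable_funPTI _ _ _ _ j S mS.
    by rewrite preimage_id.
  rewrite -[S]setCK probability_setC; last exact: measurableC.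
  rewrite (_ : 2 * r / 2 = r); last by field.
  by rewrite EFinB leeB.
- have r0 : 0 < r by rewrite /r addr_gt0// mulr_gt0.
  apply/dis_leP; first by rewrite mulr_ge0// ltW.
  split=> [[x y] [x' y']|[x y]]; rewrite /S /=; last first.
    move=> /ltW xyr; rewrite mulrC mulKf//.
    exact: le_trans (mdist_bf_proj phi psi x y) _.
  move=> xy xy'; rewrite -(emb_isom phi) -(emb_isom psi) ler_norml -/r.
  have := metric_triangle (phi x) (psi y) (phi x').
  have := metric_triangle (psi y) (psi y') (phi x').
  have := metric_triangle (psi y) (phi x) (psi y').
  have := metric_triangle (phi x) (phi x') (psi y').
  rewrite (metric_sym (psi y) (phi x)) (metric_sym (psi y') (phi x')) => ? ? ? ?.
  by apply/andP; split; lra.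
Qed.

End fields.

(** * Gluing Polish metric spaces along a relation *)

Section isometries_into_metric_spaces.
Context {R : realType} (X : polishMetricType R) (Z : metricType R) (i : X -> Z).
Context (iso : forall x y, mdist (i x) (i y) = mdist x y).

(** A Cauchy filter that lives on an isometric copy of a complete space pulls back
    to a Cauchy filter of that space; the limit found there is carried over. *)
Lemma cauchy_cvg_isometry (F : set_system Z) : ProperFilter F ->
  cauchy F -> F (range i) -> exists z : Z, F --> z.
Proof.
move=> FF /cauchyP Fc Fi.
pose G : set_system X := [set A | F (i @` A)].
have iI : injective i.
  by move=> x y ixy; apply: mdist_positivity; rewrite -iso ixy mdistxx.
have GF : ProperFilter G.
  split.
    by rewrite /G/= image_set0; exact: (filter_not_empty F).
  split => //.
  - move=> A C GA GC; rewrite /G/=.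
    have : F ((i @` A) `&` (i @` C)) by exact: filterI.
    apply: filterS.
    by move=> _ [[a Aa <-] [c Cc /iI ca]]; exists a => //; split => //; rewrite -ca.
  - by move=> A C AC; rewrite /G/=; apply: filterS => _ [a /AC Ca <-]; exists a.
have /cauchy_cvg Gcvg : cauchy G.
  apply: cauchy_exP => e e0.
  have [z Fz] := Fc _ (divr_gt0 e0 (ltr0n R 2)).
  have [w [zw [x _ xw]]] := filter_ex (filterI Fz Fi).
  have zx : ball z (e / 2) (i x) by rewrite xw.
  exists x; rewrite /G/=.
  have : F (ball z (e / 2) `&` range i) by exact: filterI.
  apply: filterS.
  move=> w' [zy [y _ yw]]; exists y => //; move: zx zy; rewrite -yw.
  rewrite !ballEmdist/= -(iso x y) => zx zy.
  have := metric_triangle (i x) z (i y); rewrite (metric_sym (i x) z); lra.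
exists (i (lim G)) => U /nbhs_ballP[e /= e0 eU].
have : G (ball (lim G) e) by apply: Gcvg; exact: nbhsx_ballx.
rewrite /G/= => H; apply: filterS H => _ [x xe <-]; apply: eU; move: xe.
by rewrite !ballEmdist/= iso.
Qed.

End isometries_into_metric_spaces.

(** The data for gluing two spaces along a relation of distortion at most twice
    [glue_len].  Related points will be at distance [glue_len]; its positivity
    keeps the two pieces apart. *)
Record gluing (R : realType) (X Y : polishMetricType R) := Gluing {
  glue_rel : set (X * Y) ;
  glue_len : R ;
  glue_len_gt0 : 0 < glue_len ;
  glue_rel_neq0 : exists p, glue_rel p ;
  glue_rel_dis : forall p q, glue_rel p -> glue_rel q ->
    `|mdist p.1 q.1 - mdist p.2 q.2| <= 2 * glue_len
}.

(** A name for the sum type that carries the gluing data, on which the metric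
    depends. *)
Definition glue (R : realType) (X Y : polishMetricType R) (G : gluing X Y) :=
  (X + Y)%type.

HB.instance Definition _ (R : realType) (X Y : polishMetricType R)
  (G : gluing X Y) := Choice.on (glue G).

Section glue_metric.
Context {R : realType} {X Y : polishMetricType R} (G : gluing X Y).
Local Notation S := (glue_rel G).
Local Notation r := (glue_len G).

(** The infimal length of the ways from [x] to [y] that cross once, along a
    related pair, from one piece to the other. *)
Definition bridge (x : X) (y : Y) : R :=
  inf [set r + mdist x p.1 + mdist p.2 y | p in S].

Lemma bridge_le x y p : S p -> bridge x y <= r + mdist x p.1 + mdist p.2 y.
Proof.
move=> Sp; apply: ge_inf; last by exists p.
exists 0 => _ [q _ <-]; rewrite !addr_ge0 ?mdist_ge0// ltW//.
exact: glue_len_gt0.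
Qed.

Lemma le_bridge x y c :
  (forall p, S p -> c <= r + mdist x p.1 + mdist p.2 y) -> c <= bridge x y.
Proof.
move=> H; apply: lb_le_inf.
  by have [p Sp] := glue_rel_neq0 G; eexists; exists p; first exact: Sp.
by move=> _ [p Sp <-]; exact: H.
Qed.

Lemma bridge_ge_len x y : r <= bridge x y.
Proof. by apply: le_bridge => p _; rewrite -addrA lerDl addr_ge0 ?mdist_ge0. Qed.

Definition glue_dist (u v : glue G) : R :=
  match u, v with
  | inl x, inl x' => mdist x x'
  | inr y, inr y' => mdist y y'
  | inl x, inr y | inr y, inl x => bridge x y
  end.

Lemma glue_distxx u : glue_dist u u = 0.
Proof. by case: u => u /=; rewrite mdistxx. Qed.

Lemma glue_dist_positivity u v : glue_dist u v = 0 -> u = v.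
Proof.
have b0 x y : bridge x y <> 0.
  apply/eqP; rewrite gt_eqF//.
  exact: lt_le_trans (glue_len_gt0 G) (bridge_ge_len x y).
by case: u v => u [] v //= => [/mdist_positivity ->|/b0|/b0|/mdist_positivity ->].
Qed.

Lemma glue_dist_sym u v : glue_dist u v = glue_dist v u.
Proof. by case: u v => u [] v //=; rewrite metric_sym. Qed.

Lemma bridge_triangle_l x x' y : bridge x y <= mdist x x' + bridge x' y.
Proof.
rewrite -lerBlDl; apply: le_bridge => p Sp; rewrite lerBlDl.
have := bridge_le x y Sp; have := metric_triangle x x' p.1; lra.
Qed.

Lemma bridge_triangle_r x y y' : bridge x y <= bridge x y' + mdist y' y.
Proof.
rewrite -lerBlDr; apply: le_bridge => p Sp; rewrite lerBlDr.
have := bridge_le x y Sp; have := metric_triangle p.2 y' y; lra.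
Qed.

(** Crossing to the other piece and back is no shortcut: this is where the bound
    on the distortion of the relation is used. *)
Lemma bridge_detour_l x x' y : mdist x x' <= bridge x y + bridge x' y.
Proof.
rewrite -lerBlDr; apply: le_bridge => p Sp; rewrite lerBlDr -lerBlDl.
apply: le_bridge => q Sq; rewrite lerBlDl.
have := glue_rel_dis Sp Sq; rewrite ler_norml => /andP[_].
have := metric_triangle x p.1 x'; have := metric_triangle p.1 q.1 x'.
have := metric_triangle p.2 y q.2.
rewrite (metric_sym q.1 x') (metric_sym y q.2); lra.
Qed.

Lemma bridge_detour_r x y y' : mdist y y' <= bridge x y + bridge x y'.
Proof.
rewrite -lerBlDr; apply: le_bridge => p Sp; rewrite lerBlDr -lerBlDl.
apply: le_bridge => q Sq; rewrite lerBlDl.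
have := glue_rel_dis Sp Sq; rewrite ler_norml => /andP[+ _].
have := metric_triangle y p.2 y'; have := metric_triangle p.2 q.2 y'.
have := metric_triangle p.1 x q.1.
rewrite (metric_sym y p.2) (metric_sym p.1 x); lra.
Qed.

Lemma glue_dist_triangle v u w : glue_dist u w <= glue_dist u v + glue_dist v w.
Proof.
case: u v w => u [] v [] w /=; try first [exact: metric_triangle |
  exact: bridge_triangle_l | exact: bridge_triangle_r |
  exact: bridge_detour_l | exact: bridge_detour_r].
- by rewrite addrC (metric_sym v) bridge_triangle_l.
- by rewrite addrC (metric_sym u) bridge_triangle_r.
Qed.

HB.instance Definition _ := isMetric.Build R (glue G)
  glue_distxx glue_dist_positivity glue_dist_sym glue_dist_triangle.

HB.instance Definition _ := isPointed.Build (glue G) (inl point).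

Definition gluel (x : X) : glue G := inl x.
Definition gluer (y : Y) : glue G := inr y.

Lemma mdist_gluel x x' : mdist (gluel x) (gluel x') = mdist x x'.
Proof. by []. Qed.

Lemma mdist_gluer y y' : mdist (gluer y) (gluer y') = mdist y y'.
Proof. by []. Qed.

Lemma mdist_glue_rel x y : S (x, y) -> mdist (gluel x) (gluer y) <= r.
Proof. by move=> /(bridge_le x y); rewrite /= !mdistxx !addr0. Qed.

(** The two pieces are at distance at least [glue_len], so a ball of that radius
    stays in one piece, and so does, eventually, a Cauchy filter. *)
Lemma glue_complete (F : set_system (glue G)) : ProperFilter F ->
  cauchy F -> cvg F.
Proof.
move=> FF Fc; have /cauchyP/(_ _ (glue_len_gt0 G))[u Fu] := Fc.
have r_bridge x y : (bridge x y < r) = false by rewrite ltNge bridge_ge_len.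
case: u Fu => [x|y] Fu.
- apply/cvg_ex; apply: (cauchy_cvg_isometry mdist_gluel) => //.
  apply: filterS Fu => -[x'|y] ; first by exists x'.
  by rewrite ballEmdist /= /mdist/= r_bridge.
- apply/cvg_ex; apply: (cauchy_cvg_isometry mdist_gluer) => //.
  apply: filterS Fu => -[x|y'] ; last by exists y'.
  by rewrite ballEmdist /= /mdist/= r_bridge.
Qed.

HB.instance Definition _ := Uniform_isComplete.Build (glue G) glue_complete.

Lemma glue_separable : exists2 D : set (glue G), countable D & dense D.
Proof.
have [a aP] := dense_sequence X; have [b bP] := dense_sequence Y.
exists (\bigcup_k [set gluel (a k); gluer (b k)]).
  by apply: bigcup_countable => // k _; exact/finite_set_countable/finite_set2.
move=> U [u Uu] oU.
have /nbhs_ballP[e /= e0 eU] : nbhs u U by exact: open_nbhs_nbhs.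
case: u Uu eU => [x|y] _ eU.
- have [k kx] := aP x _ e0; exists (gluel (a k)); split; last by exists k; [|left].
  by apply: eU; rewrite ballEmdist/= /mdist/= metric_sym.
- have [k ky] := bP y _ e0; exists (gluer (b k)); split; last by exists k; [|right].
  by apply: eU; rewrite ballEmdist/= /mdist/= metric_sym.
Qed.

HB.instance Definition _ := isSeparable.Build (glue G) glue_separable.

End glue_metric.

Section glue_field.
Context {R : realType} {B : polishMetricType R} {X Y : bField B}.
Context (G : gluing X Y).
Context (Gproj : forall p, glue_rel G p ->
  mdist (bf_proj p.1) (bf_proj p.2) <= glue_len G).

Definition glue_proj (u : glue G) : B :=
  match u with inl x => bf_proj x | inr y => bf_proj y end.

Lemma bridge_proj x y : mdist (bf_proj x) (bf_proj y) <= bridge G x y.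
Proof.
apply: le_bridge => p Sp.
have := metric_triangle (bf_proj x) (bf_proj p.1) (bf_proj y).
have := metric_triangle (bf_proj p.1) (bf_proj p.2) (bf_proj y).
have := bf_proj_lip x p.1; have := bf_proj_lip p.2 y; have := Gproj Sp; lra.
Qed.

Lemma glue_proj_lip u v : mdist (glue_proj u) (glue_proj v) <= mdist u v.
Proof.
case: u v => u [] v /=; rewrite ?bf_proj_lip ?bridge_proj//.
by rewrite metric_sym bridge_proj.
Qed.

Definition glue_field : bField B := BField glue_proj_lip.

Definition glue_embl : embedding X glue_field :=
  @Embedding _ _ X glue_field (@gluel _ _ _ G) (fun _ _ => erefl) (fun _ => erefl).

Definition glue_embr : embedding Y glue_field :=
  @Embedding _ _ Y glue_field (@gluer _ _ _ G) (fun _ _ => erefl) (fun _ => erefl).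

End glue_field.

(** * The Prokhorov distance in a common field from couplings *)

Section upper.
Context {R : realType} {B : polishMetricType R}.

Lemma measurable_fst_borel (X Y : polishMetricType R) (A : set (borel X)) :
  measurable A -> measurable (fst @^-1` A : set (borel (X * Y)%type)).
Proof.
move=> mA; rewrite -[X in measurable X]setTI.
have : measurable_fun [set: borel (X * Y)%type] (fst : borel (X * Y)%type -> borel X).
  apply: (@measurability _ _ _ (borel X) _ _ (@open X)) => // _ [U oU <-].
  rewrite setTI; apply: sub_sigma_algebra.
  by apply: open_comp => // w _; exact: cvg_fst.
exact.
Qed.

Lemma measurable_snd_borel (X Y : polishMetricType R) (A : set (borel Y)) :
  measurable A -> measurable (snd @^-1` A : set (borel (X * Y)%type)).
Proof.
move=> mA; rewrite -[X in measurable X]setTI.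
have : measurable_fun [set: borel (X * Y)%type] (snd : borel (X * Y)%type -> borel Y).
  apply: (@measurability _ _ _ (borel Y) _ _ (@open Y)) => // _ [U oU <-].
  rewrite setTI; apply: sub_sigma_algebra.
  by apply: open_comp => // w _; exact: cvg_snd.
exact.
Qed.

(** A relation of distortion at most [2 * r] is realised by a common field in which
    related points are within [r].  An empty relation imposes nothing, but a
    common field is still needed: gluing along one arbitrary pair of points, with
    a long enough bridge, provides one. *)
Lemma exists_gluing (X Y : bField B) (S : set (X * Y)) (r : R) : 0 < r ->
  (forall p q, S p -> S q -> `|mdist p.1 q.1 - mdist p.2 q.2| <= 2 * r) ->
  (forall p, S p -> mdist (bf_proj p.1) (bf_proj p.2) <= r) ->
  exists (Z : bField B) (phi : embedding X Z) (psi : embedding Y Z),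
    forall x y, S (x, y) -> mdist (phi x) (psi y) <= r.
Proof.
move=> r0 Sdis Sproj; have [Sne|Se] := pselect (exists p, S p).
  pose G := Gluing r0 Sne Sdis.
  exists (glue_field (G := G) Sproj), (glue_embl _), (glue_embr _) => x y Sxy.
  exact: (@mdist_glue_rel _ _ _ G).
pose o : X * Y := (point, point).
pose l := mdist (bf_proj o.1) (bf_proj o.2) + 1.
have l0 : 0 < l by rewrite ltr_wpDl// mdist_ge0.
have one (p : X * Y) : [set o] p -> mdist (bf_proj p.1) (bf_proj p.2) <= l.
  by move=> ->; rewrite lerDl.
have one2 (p q : X * Y) : [set o] p -> [set o] q ->
    `|mdist p.1 q.1 - mdist p.2 q.2| <= 2 * l.
  by move=> -> ->; rewrite !mdistxx subrr normr0 mulr_ge0// ltW.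
pose G := Gluing l0 (ex_intro _ o erefl) one2.
exists (glue_field (G := G) one), (glue_embl _), (glue_embr _) => x y Sxy.
by case: Se; exists (x, y).
Qed.

(** The easy half of the comparison between couplings and Prokhorov's distance:
    on [S], a pair whose first image is in [A] has its second image in the
    [t]-neighbourhood of [A]; the complement of [S] has mass at most [r].  The
    margin between [r] and [t] is needed because neighbourhoods are defined by a
    strict inequality. *)
Lemma coupling_prokhorov (X Y : mmField B) (Z : bField B)
    (phi : embedding X Z) (psi : embedding Y Z)
    (mu : probability (borel (X * Y)%type) R) (S : set (borel (X * Y)%type))
    (r t : R) : 0 < r -> r < t -> is_coupling X Y mu ->
  measurable S -> ((1 - r)%:E <= mu S)%E ->
  (forall x y, S (x, y) -> mdist (phi x) (psi y) <= r) ->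
  (prokhorov (distribution (mm_meas X) (emb_mfun phi))
             (distribution (mm_meas Y) (emb_mfun psi)) <= t%:E)%E.
Proof.
move=> r0 rt [muX muY] mS muS Sr.
have muSC : (mu (~` S) <= t%:E)%E.
  move: muS; rewrite probability_setC// -(@fineK _ (mu S)) ?fin_num_measure//.
  rewrite -EFinB !lee_fin; lra.
have transfer (U V : set (borel (X * Y)%type)) : measurable U -> measurable V ->
    U `&` S `<=` V -> (mu U <= mu V + t%:E)%E.
  move=> mU mV USV; apply: (@le_trans _ _ (mu (V `|` ~` S))).
    apply: le_measure; rewrite ?inE//.
      by apply: measurableU => //; exact: measurableC.
    by move=> w Uw; have [Sw|] := pselect (S w); [left; exact: USV|right].
  apply: (@le_trans _ _ (mu V + mu (~` S))%E); last by rewrite leeD2l.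
  by apply: measureU2 => //; exact: measurableC.
apply: ereal_inf_lbound; exists t => //; split=> [|A mA]; first exact: lt_trans rt.
have mN : measurable (nbhd A t : set (borel Z)).
  by apply: open_borel; exact: open_nbhd.
have mpre (W : bField B) (f : embedding W Z) (C : set (borel Z)) :
    measurable C -> measurable (emb_mfun f @^-1` C : set (borel W)).
  by move=> mC; exact: measurable_funPTI.
rewrite /= /distribution /pushforward -!muX -?muY; do ?exact: mpre.
split; apply: transfer;
  do ?[apply: measurable_fst_borel; exact: mpre|
       apply: measurable_snd_borel; exact: mpre].
- move=> [x y] [/= Ax Sxy]; exists (phi x) => //.
  by apply: le_lt_trans rt; exact: Sr.
- move=> [x y] [/= Ay Sxy]; exists (psi y) => //.
  by rewrite metric_sym; apply: le_lt_trans rt; exact: Sr.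
Qed.

End upper.

Theorem theorem4p6 (R : realType) (B : polishMetricType R) (X Y : mmField B) :
  dGP X Y =
  ((2^-1)%:E *
    ereal_inf [set e%:E | e in [set e : R | (0 < e)%R /\
      exists mu : probability (borel (X * Y)%type) R,
        eps_coupling X Y e mu]])%E.
Proof.
apply/le_anti/andP; split.
- rewrite lee_pdivlMl//; apply: le_ereal_inf_tmp => _ [e [e0 [mu [cmu [S [mS muS disS]]]]] <-].
  have [Sdis Sproj] := (@dis_leP _ _ X Y S e (ltW e0)).1 disS.
  have r0 : 0 < e / 2 by rewrite divr_gt0.
  have [p q Sp Sq|Z [phi [psi Sr]]] := exists_gluing r0 _ Sproj.
    by rewrite mulrC divfK//; exact: Sdis.
  rewrite -lee_pdivlMl// -EFinM mulrC; apply/lee_addgt0Pr => d d0.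
  apply: (@le_trans _ _ (prokhorov (distribution (mm_meas X) (emb_mfun phi))
                                 (distribution (mm_meas Y) (emb_mfun psi)))).
    by apply: ereal_inf_lbound; exists Z, phi, psi.
  by apply: (coupling_prokhorov r0 _ cmu mS muS Sr); rewrite ltrDl.
- apply: le_ereal_inf_tmp => _ [Z [phi [psi ->]]].
  apply: le_ereal_inf_tmp => _ [e [e0 pe] <-].
  (* Loss [d / 2] in Strassen's theorem costs [d] in the Prokhorov bound, and
     a coupling has twice this bound as its parameter. *)
  apply/lee_addgt0Pr => d d0; rewrite lee_pdivrMl//.
  apply: ereal_inf_lbound; exists (2 * (e + 2 * (d / 2))).
    split; first by rewrite mulr_gt0// addr_gt0// mulr_gt0// divr_gt0.
    apply: (@coupling_of_prokhorov _ _ _ _ _ phi psi) => //.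
      by rewrite divr_gt0.
    by move=> A mA; case: (pe A mA).
  by rewrite -EFinD -EFinM mulrC (mulrC 2 (d / 2)) divfK// mulrC.
Qed.
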